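(* Let $H$ be a Hilbert space and let $\mathcal{I},\mathcal{J}\trianglelefteq\mathcal{B}:=\mathcal{B}(H)$ be two sn-ideals. If $\mathcal{I}=\mathcal{J}\,(\mathcal{I}:\mathcal{J})$ (or, equivalently, $\mathcal{I}\subseteq\mathcal{J}\,(\mathcal{I}:\mathcal{J})$), then $$\mu_{\mathcal{I}}\preceq\mu_{\mathcal{J}},\qquad {}_r\mu_{\mathcal{I}}\preceq{}_r\mu_{\mathcal{J}}\qquad\text{and}\qquad \mu^*_{\mathcal{I}}\preceq\mu^*_{\mathcal{J}}.$$
   Context: $\|\cdot\|$ is the operator norm on $\mathcal{B}$. A symmetric norm on a two-sided ideal $\mathcal{I}\trianglelefteq\mathcal{B}$ is a norm $|||\cdot|||$ on $\mathcal{I}$ with $|||AXB|||\le\|A\|\,|||X|||\,\|B\|$ for all $X\in\mathcal{I}$, $A,B\in\mathcal{B}$, and $|||X|||=\|X\|$ for all rank-one $X\in\mathcal{I}$. A symmetrically-normed ideal (sn-ideal) is an ideal complete with respect to a symmetric norm. Convention: sn-ideals are assumed contained in the ideal $\mathcal{K}(H)$ of compact operators. For ideals $\mathcal{I},\mathcal{J}\trianglelefteq\mathcal{B}$, $(\mathcal{I}:\mathcal{J}):=\{x\in\mathcal{B}\mid x\mathcal{J}\subseteq\mathcal{I}\}=\{x\in\mathcal{B}\mid\mathcal{J}x\subseteq\mathcal{I}\}$, and the product of two ideals is the set of finite sums of products of their elements. For an sn-ideal $(\mathcal{I},|||\cdot|||_{\mathcal{I}})$: $\mu_{\mathcal{I}}$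 is the locally convex topology on $\mathcal{B}$ induced by the seminorms $x\mapsto|||xy|||_{\mathcal{I}}$, $y\in\mathcal{I}$; ${}_r\mu_{\mathcal{I}}$ is induced by the seminorms $x\mapsto|||yx|||_{\mathcal{I}}$, $y\in\mathcal{I}$; $\mu^*_{\mathcal{I}}$ is induced by both families of seminorms. For topologies, $\tau\preceq\tau'$ means that $\tau$ is coarser than (or equal to) $\tau'$. *)

(* Defs.v *)
From HB Require Import structures.
From mathcomp Require Import all_boot all_order all_algebra.
From mathcomp Require Import all_classical all_reals all_analysis.
From mathcomp Require Import complex.

Set Implicit Arguments.
Unset Strict Implicit.
Unset Printing Implicit Defensive.

Import Order.TTheory GRing.Theory Num.Theory.
Import numFieldNormedType.Exports.

Local Open Scope classical_set_scope.
Local Open Scope ring_scope.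
Local Open Scope complex_scope.

(* Hilbert spaces are complex, of arbitrary (possibly finite or zero)
   dimension; the inner product is linear in its first argument. *)
HB.mixin Record CompleteNormedModule_isHilbert (R : realType) H
    of CompleteNormedModule R[i] H := {
  inner : {dot H for (@Num.conj R[i])} ;
  innerE : forall x : H, inner x x = `|x| ^+ 2 }.

#[short(type="hilbertType")]
HB.structure Definition Hilbert (R : realType) :=
  {H of CompleteNormedModule R[i] H & CompleteNormedModule_isHilbert R H}.

(* The norms of R[i] and of its normed modules take their (nonnegative real)
   values in R[i]. *)
Definition rnorm (R : realType) (V : normedZmodType R[i]) (x : V) : R :=
  complex.Re `|x|.

Definition bounded_linear (R : realType) (H : hilbertType R) : {pred H -> H} :=
  [pred f | `[< linear f /\ continuous f >]].
Arguments bounded_linear {R} H.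

Record bounded_operator (R : realType) (H : hilbertType R) := BoundedOperator {
  bounded_operator_fun :> H -> H ;
  bounded_operatorP : bounded_operator_fun \in bounded_linear H }.

Notation "''B' ( H )" := (bounded_operator H)
  (at level 8, format "''B' ( H )") : type_scope.

Section bounded_operators.
Variables (R : realType) (H : hilbertType R).

Lemma bounded_linearP (f : H -> H) :
  reflect (linear f /\ continuous f) (f \in bounded_linear H).
Proof. exact: asboolP. Qed.

HB.instance Definition _ := [isSub for @bounded_operator_fun R H].
HB.instance Definition _ := [Choice of 'B(H) by <:].

Lemma bounded_linear_submod_closed : submod_closed (bounded_linear H).
Proof.
split=> [|a f g /bounded_linearP[lf cf] /bounded_linearP[lg cg]].
  apply/bounded_linearP; split=> [a x y|]; first by rewrite scaler0 addr0.
  exact: cst_continuous.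
apply/bounded_linearP; split=> [b x y|x].
  rewrite !fctE lf lg scalerDr !scalerA (mulrC a b) -!scalerA scalerDr.
  by rewrite -!addrA; congr (_ + _); rewrite addrCA.
apply: cvgD; last exact: cg.
by apply: cvgZr; exact: cf.
Qed.

HB.instance Definition _ :=
  GRing.isSubmodClosed.Build R[i] (H -> H) (bounded_linear H)
    bounded_linear_submod_closed.
HB.instance Definition _ := [SubChoice_isSubLmodule of 'B(H) by <:].

Lemma bounded_operator_linear (A : 'B(H)) : linear A.
Proof. by have /bounded_linearP[] := bounded_operatorP A. Qed.

HB.instance Definition _ (A : 'B(H)) :=
  GRing.isLinear.Build R[i] H H _ A (@bounded_operator_linear A).

Lemma bounded_operator_continuous (A : 'B(H)) : continuous A.
Proof. by have /bounded_linearP[] := bounded_operatorP A. Qed.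

Lemma bounded_linear_id : (@idfun H) \in bounded_linear H.
Proof. by apply/bounded_linearP; split=> // x; exact: cvg_id. Qed.

Lemma bounded_linear_comp (A B : 'B(H)) : A \o B \in bounded_linear H.
Proof.
apply/bounded_linearP; split=> [a x y /=|x]; first by rewrite !linearP.
by apply: continuous_comp; exact: bounded_operator_continuous.
Qed.

Definition id_operator : 'B(H) := BoundedOperator bounded_linear_id.

Definition comp_operator (A B : 'B(H)) : 'B(H) :=
  BoundedOperator (bounded_linear_comp A B).

Lemma comp_operatorA : associative comp_operator.
Proof. by move=> A B D; exact: val_inj. Qed.

Lemma comp_id_operator : left_id id_operator comp_operator.
Proof. by move=> A; exact: val_inj. Qed.

Lemma comp_operator_id : right_id id_operator comp_operator.
Proof. by move=> A; exact: val_inj. Qed.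

Lemma comp_operatorDl : left_distributive comp_operator +%R.
Proof. by move=> A B D; exact: val_inj. Qed.

Lemma comp_operatorDr : right_distributive comp_operator +%R.
Proof.
by move=> A B D; apply: val_inj; apply/funext => x; exact: (linearD A).
Qed.

(* Not an nzRingType, since H may be the zero space. *)
HB.instance Definition _ :=
  GRing.Zmodule_isPzRing.Build 'B(H) comp_operatorA comp_id_operator
    comp_operator_id comp_operatorDl comp_operatorDr.

Definition opnorm (A : 'B(H)) : R :=
  sup [set rnorm (A x) | x in [set x : H | rnorm x <= 1]].

Definition compact_operator (A : 'B(H)) : Prop :=
  compact (closure (A @` [set x : H | rnorm x <= 1])).

Definition rank_one (A : 'B(H)) : Prop :=
  exists2 v : H, v != 0 & range A = [set c *: v | c in [set: R[i]]].

Definition two_sided_ideal (I : set 'B(H)) : Prop :=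
  [/\ I 0,
      forall x y, I x -> I y -> I (x + y) &
      forall a x b, I x -> I (a * x * b)].

(* The values of N outside I are irrelevant. *)
Definition norm_on (I : set 'B(H)) (N : 'B(H) -> R) : Prop :=
  [/\ forall x, I x -> 0 <= N x,
      forall x, I x -> N x = 0 -> x = 0,
      forall (c : R[i]) x, I x -> N (c *: x) = rnorm c * N x &
      forall x y, I x -> I y -> N (x + y) <= N x + N y].

Definition symmetric_norm (I : set 'B(H)) (N : 'B(H) -> R) : Prop :=
  [/\ norm_on I N,
      forall a x b, I x -> N (a * x * b) <= opnorm a * N x * opnorm b &
      forall x, I x -> rank_one x -> N x = opnorm x].

Definition complete_for (I : set 'B(H)) (N : 'B(H) -> R) : Prop :=
  forall u : nat -> 'B(H), (forall n, I (u n)) ->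
    (forall e : R, 0 < e ->
       exists n0, forall m n, (n0 <= m)%N -> (n0 <= n)%N ->
         N (u m - u n) < e) ->
    exists2 x, I x & N (u n - x) @[n --> \oo] --> (0 : R).

Record sn_ideal := SnIdeal {
  sn_set :> set 'B(H) ;
  sn_norm : 'B(H) -> R ;
  sn_ideal_two_sided : two_sided_ideal sn_set ;
  sn_ideal_symmetric : symmetric_norm sn_set sn_norm ;
  sn_ideal_complete : complete_for sn_set sn_norm ;
  sn_ideal_compact : sn_set `<=` compact_operator }.

(* (I : J); for ideals of 'B(H) it is also [set x | forall y, J y -> I (y * x)]. *)
Definition residual (I J : set 'B(H)) : set 'B(H) :=
  [set x | forall y, J y -> I (x * y)].

Definition ideal_mul (I J : set 'B(H)) : set 'B(H) :=
  [set x | exists (n : nat) (y z : 'I_n -> 'B(H)),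
     [/\ forall i, I (y i), forall i, J (z i) & x = \sum_i y i * z i]].

End bounded_operators.

Definition seminorm_space (R : realType) (V : zmodType)
  (P : set (V -> R)) : Type := V.

Section seminorm_topology.
Variables (R : realType) (V : zmodType) (P : set (V -> R)).

Definition seminorm_balls : set (set V) :=
  [set U | exists (p : V -> R) (x : V) (e : R),
     [/\ P p, 0 < e & U = [set y | p (y - x) < e]]].

HB.instance Definition _ := Choice.on (seminorm_space P).
HB.instance Definition _ :=
  isSubBaseTopological.Build (seminorm_space P) seminorm_balls id.

(* The locally convex topology on V induced by a family P of seminorms. *)
Definition seminorm_topology : Topological V :=
  Topological.class (seminorm_space P).

End seminorm_topology.

Definition coarser (T : Type) (t t' : Topological T) : Prop :=
  @open (Topological.Pack t) `<=` @open (Topological.Pack t').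

Section mu_topologies.
Variables (R : realType) (H : hilbertType R) (I : sn_ideal H).

Definition mu_seminorms : set ('B(H) -> R) :=
  [set fun x => sn_norm I (x * y) | y in I].

Definition rmu_seminorms : set ('B(H) -> R) :=
  [set fun x => sn_norm I (y * x) | y in I].

Definition mu : Topological 'B(H) := seminorm_topology mu_seminorms.
Definition rmu : Topological 'B(H) := seminorm_topology rmu_seminorms.
Definition mu_star : Topological 'B(H) :=
  seminorm_topology (mu_seminorms `|` rmu_seminorms).

End mu_topologies.

(* Main.v *)
From HB Require Import structures.
Require Import Defs.
From mathcomp Require Import all_boot all_order all_algebra.
From mathcomp Require Import all_classical all_reals all_analysis.
From mathcomp Require Import complex.
From mathcomp Require Import ring lra.

(** For y in I, write y as a finite sum of products a_i z_i with a_i in J and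
    z_i in (I : J).  Then |||x y|||_I <= sum_i |||x a_i z_i|||_I, and it is enough
    to know that w |-> w z_i is bounded from J to I: the seminorm of x given by y
    is then at most sum_i C_i |||x a_i|||_J, a combination of seminorms that define
    mu_J ([mu_seminorm_dominated], [coarser_seminorm_topology]).

    Boundedness is the closed graph theorem ([closed_graph]).  A symmetric norm
    dominates the operator norm, as one sees by multiplying with rank-one operators
    ([le_sn_norm]); hence both ideals embed continuously in B(H), and a linear map
    from J to I that is bounded for the operator norm has a closed graph.  The
    completeness of J enters through a Baire category argument ([baire_level]), that
    of I through successive approximation.

    Everything that involves the other side, namely the inclusion
    J (I : J) in I, the boundedness of w |-> w z (as (I : J) is defined by
    z J in I), and the seminorms x |-> |||y x|||_I, follows by passing to adjoints,
    because two-sided ideals of B(H) are self-adjoint ([ideal_adjoint]).  That fact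
    comes from the polar decomposition: z = u |z| gives z^* = u^* z u^*, so z^* lies
    in the ideal generated by z ([adjoint_in_ideal]).  Two tools produce the polar
    decomposition.  A factorisation lemma in the style of Douglas ([douglas]), which
    also yields the existence of adjoints, is obtained by minimising a quadratic
    functional on the range of an operator.  After scaling, z^* z = 1 - T with
    T a symmetric contraction, and its square root is 1 - Y for Y the limit of the
    iteration Y |-> (T + Y^2) / 2, which is controlled in norm by its scalar
    counterpart ([symmetric_sqrt]).

    The estimates on H use only the real part [ip] of the inner product, a real
    symmetric bilinear form which still determines adjoints. *)

Set Implicit Arguments.
Unset Strict Implicit.
Unset Printing Implicit Defensive.

Import Order.TTheory GRing.Theory Num.Theory.
Import numFieldNormedType.Exports.

Local Open Scope classical_set_scope.
Local Open Scope ring_scope.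

(** * Real-valued norms and the real inner product *)

Section RealNorm.
Variable R : realType.

Lemma rnormE (V : normedZmodType R[i]) (x : V) : `|x| = (rnorm x)%:C%C.
Proof. by rewrite /rnorm RRe_real ?normr_real. Qed.

Lemma rnorm_ge0 (V : normedZmodType R[i]) (x : V) : 0 <= rnorm x.
Proof. by rewrite -ler0c -rnormE. Qed.

Lemma rnorm0 (V : normedZmodType R[i]) : rnorm (0 : V) = 0.
Proof. by apply: (@complexI R); rewrite -rnormE normr0. Qed.

Lemma rnorm_eq0 (V : normedZmodType R[i]) (x : V) : rnorm x = 0 -> x = 0.
Proof. by move=> x0; apply/eqP; rewrite -normr_eq0 rnormE x0. Qed.

Lemma ler_rnormD (V : normedZmodType R[i]) (x y : V) :
  rnorm (x + y) <= rnorm x + rnorm y.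
Proof. by rewrite -lecR rmorphD/= -!rnormE ler_normD. Qed.

Lemma rnormN (V : normedZmodType R[i]) (x : V) : rnorm (- x) = rnorm x.
Proof. by rewrite /rnorm normrN. Qed.

Lemma rdistC (V : normedZmodType R[i]) (x y : V) : rnorm (x - y) = rnorm (y - x).
Proof. by rewrite /rnorm distrC. Qed.

Lemma ler_rdistD (V : normedZmodType R[i]) (z x y : V) :
  rnorm (x - y) <= rnorm (x - z) + rnorm (z - y).
Proof. by apply: le_trans (ler_rnormD _ _); rewrite addrA subrK. Qed.

Lemma rnormZ (V : normedModType R[i]) (c : R[i]) (x : V) :
  rnorm (c *: x) = rnorm c * rnorm x.
Proof. by apply: (@complexI R); rewrite rmorphM/= -!rnormE normrZ. Qed.

Lemma rnorm_real (r : R) : rnorm (r%:C%C) = `|r|.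
Proof. by rewrite /rnorm normc_def/= expr0n addr0 sqrtr_sqr. Qed.

End RealNorm.

Section HilbertBasics.
Variables (R : realType) (H : hilbertType R).
Implicit Types x y : H.

Lemma hilbert_complete (u : nat -> H) :
  (forall e : R, 0 < e -> exists n0, forall m n, (n0 <= m)%N -> (n0 <= n)%N ->
     rnorm (u m - u n) < e) ->
  exists x, forall e : R, 0 < e -> exists n0, forall n, (n0 <= n)%N ->
    rnorm (u n - x) < e.
Proof.
move=> uC.
have /cauchy_cvgP uc : cauchy (u n @[n --> \oo]).
  apply/cauchyP => e e0.
  have [er e0'] : e = (complex.Re e)%:C%C /\ 0 < complex.Re e.
    by rewrite -ltcR !RRe_real// gtr0_real.
  have [n0 un0] := uC _ e0'.
  exists (u n0); exists n0 => // n /= n0n.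
  by rewrite -ball_normE/= rnormE er ltcR; exact: un0.
exists (lim (u n @[n --> \oo])) => e e0.
have e0' : 0 < e%:C%C :> R[i] by rewrite ltcR.
have /cvgrPdist_lt /(_ _ e0')[n0 _ h] := uc.
by exists n0 => n /h; rewrite rnormE ltcR rdistC.
Qed.

Lemma bounded_linearW (f : H -> H) (C : R) : linear f ->
  (forall x, rnorm (f x) <= C * rnorm x) -> f \in bounded_linear H.
Proof.
move=> lf fC; apply/bounded_linearP; split=> //.
pose isL := GRing.isLinear.Build R[i] H H *:%R f lf.
pose F : {linear H -> H} := HB.pack f isL.
apply: (@bounded_linear_continuous _ _ _ F); apply/linear_boundedP.
exists C%:C%C; split=> [|M CM x]; first by rewrite realE !lecR -realE num_real.
rewrite (@le_trans _ _ (C%:C%C * `|x|))//; last by rewrite ler_wpM2r// ltW.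
by rewrite !rnormE -rmorphM lecR fC.
Qed.

Lemma bounded_operator_bound (A : 'B(H)) :
  exists2 C : R, 0 <= C & forall x, rnorm (A x) <= C * rnorm x.
Proof.
have /linear_bounded_continuous/linear_boundedP := @bounded_operator_continuous R H A.
move=> [M [Mr h]].
have {}Mr : M = (complex.Re M)%:C%C by rewrite RRe_real.
have := h ((complex.Re M + 1)%:C%C).
rewrite {1}Mr ltcR ltrDl ltr01 => /(_ isT) hA.
exists `|complex.Re M + 1| => // x.
rewrite (@le_trans _ _ ((complex.Re M + 1) * rnorm x))//.
  by rewrite -lecR rmorphM/= -!rnormE; exact: hA.
by rewrite ler_wpM2r ?rnorm_ge0// ler_norm.
Qed.

Lemma opnorm_has_sup (A : 'B(H)) :
  has_sup [set rnorm (A x) | x in [set x : H | rnorm x <= 1]].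
Proof.
split; first by exists (rnorm (A 0)); exists 0 => //=; rewrite rnorm0.
have [C C0 AC] := bounded_operator_bound A.
exists C => _ [x /= x1 <-]; apply: le_trans (AC x) _.
by rewrite ler_piMr.
Qed.

Lemma opnorm_ge0 (A : 'B(H)) : 0 <= opnorm A.
Proof.
apply: le_trans (rnorm_ge0 (A 0)) _.
by apply: ub_le_sup; [case: (opnorm_has_sup A)|exists 0; rewrite //= rnorm0].
Qed.

Lemma le_opnorm (A : 'B(H)) x : rnorm (A x) <= opnorm A * rnorm x.
Proof.
have [->|x0] := eqVneq x 0; first by rewrite linear0 rnorm0 mulr0.
have nx0 : 0 < rnorm x.
  by rewrite lt_neqAle rnorm_ge0 andbT eq_sym; apply: contra_neq x0 => /rnorm_eq0.
rewrite -ler_pdivrMr// mulrC.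
have -> : (rnorm x)^-1 * rnorm (A x) = rnorm (A ((rnorm x)^-1%:C%C *: x)).
  by rewrite linearZ rnormZ rnorm_real ger0_norm ?invr_ge0 ?ltW.
apply: ub_le_sup; first by case: (opnorm_has_sup A).
exists ((rnorm x)^-1%:C%C *: x) => //=.
by rewrite rnormZ rnorm_real ger0_norm ?invr_ge0 ?rnorm_ge0// mulVf// gt_eqF.
Qed.

Lemma opnorm_le (A : 'B(H)) (C : R) : 0 <= C ->
  (forall x, rnorm (A x) <= C * rnorm x) -> opnorm A <= C.
Proof.
move=> C0 AC; apply: ge_sup; first by case: (opnorm_has_sup A).
by move=> _ [x /= x1 <-]; apply: le_trans (AC x) _; rewrite ler_piMr.
Qed.

Definition ip x y : R := complex.Re (inner x y).

Lemma ReD (a b : R[i]) : complex.Re (a + b) = complex.Re a + complex.Re b.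
Proof. by case: a; case: b. Qed.

Lemma ipC x y : ip x y = ip y x.
Proof. by rewrite /ip hermC/= expr0 mul1r; case: (inner y x : R[i]). Qed.

Lemma ipDl x y z : ip (x + y) z = ip x z + ip y z.
Proof. by rewrite /ip linearDl ReD. Qed.

Lemma ipDr x y z : ip z (x + y) = ip z x + ip z y.
Proof. by rewrite !(ipC z) ipDl. Qed.

Lemma ReMl (c : R) (a : R[i]) : complex.Re (c%:C%C * a) = c * complex.Re a.
Proof. by case: a => a b /=; rewrite mul0r subr0. Qed.

Lemma ipZl (c : R) x y : ip (c%:C%C *: x) y = c * ip x y.
Proof. by rewrite /ip linearZl_LR ReMl. Qed.

Lemma ipZr (c : R) x y : ip x (c%:C%C *: y) = c * ip x y.
Proof. by rewrite !(ipC x) ipZl. Qed.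

Lemma ipZJ (c : R[i]) x y : ip (Num.conj c *: x) y = ip x (c *: y).
Proof. by rewrite /ip linearZl_LR linearZr_LR. Qed.

Lemma ReN (a : R[i]) : complex.Re (- a) = - complex.Re a.
Proof. by case: a. Qed.

Lemma ipNl x y : ip (- x) y = - ip x y.
Proof. by rewrite /ip linearNl ReN. Qed.

Lemma ipNr x y : ip x (- y) = - ip x y.
Proof. by rewrite !(ipC x) ipNl. Qed.

Lemma ipBl x y z : ip (x - y) z = ip x z - ip y z.
Proof. by rewrite ipDl ipNl. Qed.

Lemma ipBr x y z : ip z (x - y) = ip z x - ip z y.
Proof. by rewrite ipDr ipNr. Qed.

Lemma ip_norm x : ip x x = rnorm x ^+ 2.
Proof. by rewrite /ip innerE rnormE -rmorphXn. Qed.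

Lemma ip_eq0 x : ip x x = 0 -> x = 0.
Proof. by rewrite ip_norm => /eqP; rewrite sqrf_eq0 => /eqP/rnorm_eq0. Qed.

Lemma rnormD2 x y : rnorm (x + y) ^+ 2 = rnorm x ^+ 2 + 2 * ip x y + rnorm y ^+ 2.
Proof. rewrite -!ip_norm !ipDl !ipDr (ipC y x); ring. Qed.

Lemma rnormB2 x y : rnorm (x - y) ^+ 2 = rnorm x ^+ 2 - 2 * ip x y + rnorm y ^+ 2.
Proof. rewrite -!ip_norm !ipBl !ipBr (ipC y x); ring. Qed.

Lemma ip_le x y : ip x y <= rnorm x * rnorm y.
Proof.
have := ler_rnormD x y.
rewrite -(@ler_pXn2r _ 2)// ?nnegrE ?rnorm_ge0 ?addr_ge0 ?rnorm_ge0//.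
rewrite rnormD2; nra.
Qed.

Lemma ip_abs_le x y : `|ip x y| <= rnorm x * rnorm y.
Proof.
by rewrite ler_norml ip_le andbT lerNl -ipNl (le_trans (ip_le _ _))// rnormN.
Qed.

End HilbertBasics.

(** * Riesz representation, adjoints and Douglas factorisation *)

Section RangeRiesz.
Variables (R : realType) (H : hilbertType R).
Implicit Types x y : H.

Lemma ler_vanishing (a b K : R) :
  (forall d, 0 < d -> a <= b + d * K) -> a <= b.
Proof.
move=> h; rewrite leNgt; apply/negP => ba.
have K0 : 0 < K by have := h 1 ltr01; lra.
have d0 : 0 < (a - b) / K / 2 by rewrite !divr_gt0 ?subr_gt0.
have := h _ d0.
have -> : (a - b) / K / 2 * K = (a - b) / 2 by field; rewrite gt_eqF.
lra.
Qed.

Lemma eq_vanishing (a b K : R) :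
  (forall d, 0 < d -> `|a - b| <= d * K) -> a = b.
Proof.
move=> h; apply/eqP; rewrite -subr_eq0 -normr_le0.
by apply: (@ler_vanishing _ _ K) => d /h; rewrite add0r.
Qed.

Lemma natSinv_lt (e : R) : 0 < e ->
  exists n0, forall n, (n0 <= n)%N -> n.+1%:R^-1 < e.
Proof. by move=> e0; have [n0 _ h] := near_infty_natSinv_lt (PosNum e0); exists n0. Qed.

(** Riesz representation, relative to the range of [g]: the representing vector
    lies in the closure of that range and is found as the limit of [g x] along a
    minimising sequence of |g x|^2 - 2 phi(x).  Working over the domain of [g]
    avoids speaking of subspaces and of functionals defined only on a range. *)
Lemma riesz_range (g : 'B(H)) (phi : H -> R) (K : R) :
  (forall x y, phi (x + y) = phi x + phi y) ->
  (forall (c : R) x, phi (c%:C%C *: x) = c * phi x) ->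
  (forall x, phi x <= K * rnorm (g x)) ->
  exists r, [/\ forall x, ip (g x) r = phi x, rnorm r <= `|K| &
    forall d : R, 0 < d -> exists x, rnorm (g x - r) < d].
Proof.
move=> phiD phiZ phiK.
pose Q x := rnorm (g x) ^+ 2 - 2 * phi x.
pose E := [set Q x | x in [set: H]].
have hE : has_inf E.
  split; first by exists (Q 0); exists 0.
  exists (- K ^+ 2) => _ [x _ <-]; rewrite /Q.
  have := phiK x; have := sqr_ge0 (rnorm (g x) - K); rewrite sqrrB; lra.
set m := inf E.
have mQ x : m <= Q x by apply: ge_inf; [case: hE|exists x].
have /choice[xs xsP] (n : nat) : exists x, Q x < m + n.+1%:R^-1.
  have [|_ [x _ <-] ?] := @inf_adherent _ E n.+1%:R^-1 _ hE; last by exists x.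
  by rewrite invr_gt0.
(* The parallelogram law at the midpoint makes minimising sequences Cauchy. *)
have dist x y : rnorm (g x - g y) ^+ 2 <= 2 * (Q x - m) + 2 * (Q y - m).
  have := mQ ((2^-1)%:C%C *: (x + y)).
  rewrite /Q phiZ phiD linearZ linearD/= rnormZ rnorm_real exprMn.
  rewrite real_normK ?num_real// rnormB2 rnormD2.
  move: (rnorm (g x)) (rnorm (g y)) (ip _ _) (phi x) (phi y) => a b c p q.
  lra.
have [|r rP] := @hilbert_complete _ _ (g \o xs).
  move=> e e0.
  have e20 : 0 < e ^+ 2 / 4 by rewrite divr_gt0// exprn_gt0.
  have [n0 n0P] := natSinv_lt e20.
  exists n0 => i j ni nj /=; rewrite -(@ltr_pXn2r _ 2)// ?nnegrE ?rnorm_ge0 ?ltW//.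
  have := dist (xs i) (xs j); have := xsP i; have := xsP j.
  have := n0P _ ni; have := n0P _ nj.
  move: (i.+1%:R^-1) (j.+1%:R^-1) => a b; lra.
have approx d : 0 < d -> exists x, rnorm (g x - r) < d /\ Q x < m + d ^+ 2.
  move=> d0; have [n1 n1P] := rP _ d0.
  have d20 : 0 < d ^+ 2 by rewrite exprn_gt0.
  have [n2 n2P] := natSinv_lt d20.
  exists (xs (maxn n1 n2)); split; first by apply: n1P; rewrite leq_maxl.
  by apply: lt_le_trans (xsP _) _; rewrite lerD2l ltW// n2P// leq_maxr.
(* First variation: an almost minimiser is almost critical in every direction. *)
have rE x : ip (g x) r = phi x.
  apply: (@eq_vanishing _ _ (2 * rnorm (g x) + 1)) => d d0.
  have [x0 [x0r Qx0]] := approx _ d0.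
  set b := rnorm (g x); have b0 : 0 <= b := rnorm_ge0 _.
  set a := ip (g x) (g x0) - phi x.
  have a_le : `|a| <= d * (b + 1).
    rewrite -(@ler_pXn2r _ 2)// ?nnegrE ?mulr_ge0 ?addr_ge0 ?(ltW d0)//.
    rewrite real_normK ?num_real//.
    (* Nearly the optimal step - a / b^2; b + 1 keeps the divisor nonzero. *)
    pose t := - a / (b + 1) ^+ 2.
    have := mQ (x0 + t%:C%C *: x).
    rewrite /Q linearD linearZ/= phiD phiZ rnormD2 rnormZ rnorm_real exprMn.
    rewrite real_normK ?num_real// ipZr (ipC (g x0)).
    have tE : t * (b + 1) ^+ 2 = - a by rewrite divfK// gt_eqF// exprn_gt0// ltr_wpDl.
    rewrite -/b => h.
    have {}h : - (t ^+ 2 * b ^+ 2 + 2 * t * a) <= d ^+ 2.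
      move: h Qx0; rewrite /Q /a; lra.
    have h2 : t ^+ 2 * (b + 1) ^+ 2 = - (t * a).
      by rewrite expr2 -mulrA tE mulrN.
    have h3 : - (t * a) <= d ^+ 2.
      apply: le_trans h; have : 0 <= t ^+ 2 by exact: sqr_ge0.
      nra.
    have h4 : - (t * a) * (b + 1) ^+ 2 = a ^+ 2.
      by rewrite mulNr mulrAC tE mulNr opprK expr2.
    rewrite exprMn -h4 ler_wpM2r// exprn_ge0// addr_ge0//.
  have -> : ip (g x) r - phi x = a - ip (g x) (g x0 - r) by rewrite /a ipBr; ring.
  apply: le_trans (ler_normB _ _) _.
  have := ip_abs_le (g x) (g x0 - r); rewrite -/b => h.
  have : b * rnorm (g x0 - r) <= b * d by rewrite ler_wpM2l// ltW.
  lra.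
have rapp d : 0 < d -> exists x, rnorm (g x - r) < d.
  by move=> /approx[x [? _]]; exists x.
exists r; split=> //.
have [->|r0] := eqVneq (rnorm r) 0; first exact: normr_ge0.
have {}r0 : 0 < rnorm r by rewrite lt_neqAle eq_sym r0 rnorm_ge0.
rewrite -(ler_pM2r r0) -expr2 -ip_norm.
apply: (@ler_vanishing _ _ (`|K| + rnorm r)) => d d0.
have [x xr] := rapp _ d0.
have -> : ip r r = phi x - ip (g x - r) r by rewrite ipBl rE; ring.
have h1 := phiK x.
have h2 : K * rnorm (g x) <= `|K| * (rnorm r + d).
  apply: (@le_trans _ _ (`|K| * rnorm (g x))).
    by rewrite ler_wpM2r ?rnorm_ge0// ler_norm.
  rewrite ler_wpM2l//.
  have := ler_rnormD (g x - r) r; rewrite subrK; lra.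
have h3 : - ip (g x - r) r <= d * rnorm r.
  rewrite -ipNl; apply: le_trans (ip_le _ _) _; rewrite rnormN.
  by rewrite ler_wpM2r ?rnorm_ge0// ltW.
lra.
Qed.

Lemma operator_of_fun (f : H -> H) (K : R) : linear f ->
  (forall x, rnorm (f x) <= K * rnorm x) -> exists A : 'B(H), A =1 f.
Proof. by move=> lf fK; exists (BoundedOperator (bounded_linearW lf fK)). Qed.

(** If |f x| <= C |g x| then f^* = g^* D.  The first conclusion states that
    factorisation without mentioning adjoints, so that g = 1 constructs the adjoint
    of f.  The second one places the range of D in the closure of the range of g,
    in the form range D is orthogonal to whatever is orthogonal to range g; it
    makes D unique, hence linear. *)
Lemma douglas (f g : 'B(H)) (C : R) : 0 <= C ->
  (forall x, rnorm (f x) <= C * rnorm (g x)) ->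
  exists2 D : 'B(H), forall x v, ip (g x) (D v) = ip (f x) v &
    forall v y, (forall x, ip (g x) y = 0) -> ip (D v) y = 0.
Proof.
move=> C0 fg.
have /choice[D DP] v : exists r, [/\ forall x, ip (g x) r = ip (f x) v,
    rnorm r <= `|C * rnorm v| &
    forall d : R, 0 < d -> exists x, rnorm (g x - r) < d].
  apply: riesz_range => [x y|c x|x].
  - by rewrite linearD ipDl.
  - by rewrite linearZ ipZl.
  - by apply: le_trans (ip_le _ _) _; rewrite mulrAC ler_wpM2r ?rnorm_ge0.
have Dorth v y : (forall x, ip (g x) y = 0) -> ip (D v) y = 0.
  move=> gy; apply: (@eq_vanishing _ _ (rnorm y)) => d d0.
  have [_ _ /(_ _ d0)[x xd]] := DP v.
  have -> : ip (D v) y - 0 = - ip (g x - D v) y by rewrite ipBl gy; ring.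
  rewrite normrN; apply: le_trans (ip_abs_le _ _) _.
  by rewrite ler_wpM2r ?rnorm_ge0// ltW.
have DE x v : ip (g x) (D v) = ip (f x) v by have [] := DP v.
(* The defect of linearity w is orthogonal to range g, hence to D, hence to itself. *)
have Dl : linear D.
  move=> c u v; apply/eqP; rewrite -subr_eq0; apply/eqP/ip_eq0.
  set w := D _ - _.
  have gw x : ip (g x) w = 0.
    rewrite /w ipBr ipDr !DE ipDr -!ipZJ.
    have -> : Num.conj c *: g x = g (Num.conj c *: x) by rewrite linearZ.
    have -> : Num.conj c *: f x = f (Num.conj c *: x) by rewrite linearZ.
    by rewrite DE subrr.
  rewrite {1}/w ipBl ipDl (Dorth _ _ gw) (Dorth _ _ gw).
  rewrite -[c]conjCK ipZJ.
  have -> : ip (D u) (Num.conj c *: w) = 0.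
    apply: Dorth => x; rewrite -ipZJ.
    have -> : Num.conj (Num.conj c) *: g x = g (c *: x) by rewrite conjCK linearZ.
    exact: gw.
  by rewrite addr0 subr0.
have DC v : rnorm (D v) <= C * rnorm v.
  by have [_ + _] := DP v; rewrite ger0_norm// mulr_ge0// rnorm_ge0.
have [A AE] := operator_of_fun Dl DC.
by exists A => *; rewrite AE; [exact: DE|exact: Dorth].
Qed.

Lemma adjoint_exists (A : 'B(H)) :
  exists B : 'B(H), forall x y, ip (A x) y = ip x (B y).
Proof.
have [C C0 AC] := bounded_operator_bound A.
have [|D DE _] := @douglas A 1 C C0; first exact: AC.
by exists D => x y; rewrite -DE.
Qed.

End RangeRiesz.

(** * Square roots and polar decomposition *)

Section Polar.
Variables (R : realType) (H : hilbertType R).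
Implicit Types x y : H.

Lemma operator_ext (A B : 'B(H)) : A =1 B -> A = B.
Proof. by move=> AB; apply: val_inj; apply/funext. Qed.

Lemma operatorB (A : 'B(H)) x y : A (x - y) = A x - A y.
Proof. exact: linearB. Qed.

Lemma ip_ext u v : (forall x : H, ip x u = ip x v) -> u = v.
Proof.
move=> uv; apply/eqP; rewrite -subr_eq0; apply/eqP/ip_eq0.
by rewrite ipBr uv subrr.
Qed.

(** As [A] and [B] are complex linear, agreement of the real parts of the inner
    products forces agreement of the inner products themselves. *)
Definition adjoint_pair (A B : 'B(H)) := forall x y, ip (A x) y = ip x (B y).

Lemma adjoint_pair_sym (A B : 'B(H)) : adjoint_pair A B -> adjoint_pair B A.
Proof. by move=> AB x y; rewrite ipC -AB ipC. Qed.

Lemma adjoint_bound (A B : 'B(H)) (C : R) : adjoint_pair A B ->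
  (forall x, rnorm (A x) <= C * rnorm x) -> forall y, rnorm (B y) <= C * rnorm y.
Proof.
move=> AB AC y; have [->|B0] := eqVneq (rnorm (B y)) 0.
  have := AC y; have := rnorm_ge0 (A y); lra.
have {}B0 : 0 < rnorm (B y) by rewrite lt_neqAle eq_sym B0 rnorm_ge0.
rewrite -(ler_pM2r B0) -expr2 -ip_norm -AB (le_trans (ip_le _ _))//.
by rewrite mulrAC ler_wpM2r// rnorm_ge0.
Qed.

(** Square root of 1 - T for a symmetric contraction T.  If Y solves
    Y = (T + Y^2) / 2 then (1 - Y)^2 = 1 - T.  The iterates started at 0 and their
    increments are bounded by those of the scalar recursion with T replaced by 1,
    which increases and never exceeds 1. *)
Lemma symmetric_sqrt (T : 'B(H)) : adjoint_pair T T ->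
  (forall x, rnorm (T x) <= rnorm x) ->
  exists2 S : 'B(H), adjoint_pair S S & forall x, S (S x) = x - T x.
Proof.
move=> Tsym T1.
pose Y := fix Y n : 'B(H) :=
  if n is n'.+1 then (2^-1)%:C%C *: (T + Y n' * Y n') else 0.
pose y := fix y n : R := if n is n'.+1 then 2^-1 * (1 + y n' ^+ 2) else 0.
have Y0 x : Y 0%N x = 0 by [].
have YS n x : Y n.+1 x = (2^-1)%:C%C *: (T x + Y n (Y n x)) by [].
(* Y'^2 - Y^2 = Y' (Y' - Y) + (Y' - Y) Y, which holds without commutation. *)
have YsubS n x : Y n.+2 x - Y n.+1 x =
    (2^-1)%:C%C *: (Y n.+1 (Y n.+1 x - Y n x) + (Y n.+1 (Y n x) - Y n (Y n x))).
  rewrite YS [in X in _ - X]YS -scalerBr opprD addrACA subrr add0r; congr (_ *: _).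
  by rewrite operatorB addrA subrK.
have y0 n : 0 <= y n.
  by elim: n => //= n _; rewrite mulr_ge0 ?invr_ge0// addr_ge0// sqr_ge0.
have y1 n : y n <= 1.
  elim: n => //= n IH; have := y0 n; nra.
have Yy n x : rnorm (Y n x) <= y n * rnorm x.
  elim: n x => [|n IH] x; first by rewrite /= rnorm0 mul0r.
  rewrite YS rnormZ rnorm_real ger0_norm ?invr_ge0//=.
  have := ler_rnormD (T x) (Y n (Y n x)); have := T1 x.
  have := IH (Y n x).
  have : y n * rnorm (Y n x) <= y n * (y n * rnorm x) by rewrite ler_wpM2l.
  move: (rnorm _) (rnorm _) (rnorm _) (rnorm _) (rnorm _) => *; lra.
have dY n x : rnorm (Y n.+1 x - Y n x) <= (y n.+1 - y n) * rnorm x.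
  elim: n x => [|n IH] x.
    rewrite YS !Y0 addr0 subr0 rnormZ rnorm_real ger0_norm ?invr_ge0//=.
    by rewrite expr0n addr0 subr0 mulr1 ler_wpM2l// invr_ge0.
  rewrite YsubS rnormZ rnorm_real ger0_norm ?invr_ge0//.
  have h1 := ler_rnormD (Y n.+1 (Y n.+1 x - Y n x)) (Y n.+1 (Y n x) - Y n (Y n x)).
  have h2 := IH (Y n x).
  have h3 := Yy n.+1 (Y n.+1 x - Y n x).
  have h4 : y n.+1 * rnorm (Y n.+1 x - Y n x) <=
      y n.+1 * ((y n.+1 - y n) * rnorm x) by rewrite ler_wpM2l.
  have dy : 0 <= y n.+1 - y n by rewrite /=; have := sqr_ge0 (y n - 1); nra.
  have h5 : (y n.+1 - y n) * rnorm (Y n x) <= (y n.+1 - y n) * (y n * rnorm x).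
    by rewrite ler_wpM2l.
  have -> : y n.+2 - y n.+1 = 2^-1 * (y n.+1 + y n) * (y n.+1 - y n) by rewrite /=; ring.
  move: h1 h2 h3 h4 h5; move: (rnorm _) (rnorm _) (rnorm _) (rnorm _) (rnorm _) (rnorm _).
  move: (y n.+1) (y n) => *; lra.
have ydist m n x : (n <= m)%N -> rnorm (Y m x - Y n x) <= (y m - y n) * rnorm x.
  move=> /subnK <-; elim: (m - n)%N => [|k IH].
    by rewrite add0n !subrr rnorm0 mul0r.
  apply: le_trans (ler_rdistD (Y (k + n)%N x) _ _) _.
  have := dY (k + n)%N x; rewrite addSn; lra.
have hy : has_sup (range y).
  by split; [exists (y 0%N); exists 0%N|exists 1 => _ [n _ <-]].
have yapp d : 0 < d -> exists n0, forall n, (n0 <= n)%N -> y n - y n0 <= d.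
  move=> d0; have [_ [n0 _ <-] h] := sup_adherent d0 hy.
  exists n0 => n _; have : y n <= sup (range y).
    by apply: ub_le_sup; [case: hy|exists n].
  lra.
have /choice[L LP] x : exists l, forall e : R, 0 < e ->
    exists n0, forall n, (n0 <= n)%N -> rnorm (Y n x - l) < e.
  apply: hilbert_complete => e e0.
  have d0 : 0 < e / (2 * rnorm x + 1).
    by rewrite divr_gt0// ltr_wpDl// mulr_ge0// rnorm_ge0.
  have [n0 n0P] := yapp _ d0; exists n0 => m n nm nn.
  apply: le_lt_trans (ler_rdistD (Y n0 x) _ _) _.
  rewrite (rdistC (Y n0 x)).
  have := ydist _ _ x nm; have := ydist _ _ x nn.
  have h k : (n0 <= k)%N ->
      (y k - y n0) * rnorm x <= e / (2 * rnorm x + 1) * rnorm x.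
    by move=> /n0P ?; rewrite ler_wpM2r ?rnorm_ge0.
  have := h _ nm; have := h _ nn.
  have : e / (2 * rnorm x + 1) * (2 * rnorm x + 1) = e.
    by rewrite divfK// gt_eqF// ltr_wpDl// mulr_ge0// rnorm_ge0.
  move: d0; move: (e / _) => d; lra.
have Lapp x e : 0 < e -> exists n0, forall n, (n0 <= n)%N -> rnorm (Y n x - L x) < e.
  exact: LP.
have L1 x : rnorm (L x) <= 1 * rnorm x.
  apply: (@ler_vanishing _ _ _ 1) => d d0; have [n /(_ n (leqnn _)) h] := Lapp x _ d0.
  have := ler_rdistD (Y n x) (L x) 0; rewrite !subr0 rdistC.
  have := Yy n x; have : y n * rnorm x <= 1 * rnorm x by rewrite ler_wpM2r// rnorm_ge0.
  lra.
have Llin : linear L.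
  move=> c u v; apply/eqP; rewrite -subr_eq0; apply/eqP/rnorm_eq0.
  apply/eqP; rewrite eq_le rnorm_ge0 andbT.
  apply: (@ler_vanishing _ _ _ (2 + rnorm c)) => d d0.
  have [n1 n1P] := Lapp (c *: u + v) _ d0.
  have [n2 n2P] := Lapp u _ d0; have [n3 n3P] := Lapp v _ d0.
  pose n := (n1 + n2 + n3)%N.
  have -> : L (c *: u + v) - (c *: L u + L v) =
     - (Y n (c *: u + v) - L (c *: u + v)) + (c *: (Y n u - L u) + (Y n v - L v)).
    have -> : Y n (c *: u + v) = c *: Y n u + Y n v by rewrite linearP.
    rewrite scalerBr opprB.
    rewrite [X in _ = _ + X](_ : _ = c *: Y n u + Y n v - (c *: L u + L v)).
      by rewrite addrA subrK.
    by rewrite addrACA opprD.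
  apply: le_trans (ler_rnormD _ _) _; rewrite rnormN add0r.
  have h := ler_rnormD (c *: (Y n u - L u)) (Y n v - L v).
  have h1 : rnorm (Y n (c *: u + v) - L (c *: u + v)) < d.
    by apply: n1P; rewrite /n -addnA leq_addr.
  have h2 : rnorm c * rnorm (Y n u - L u) <= rnorm c * d.
    by rewrite ler_wpM2l ?rnorm_ge0// ltW// n2P// /n addnAC leq_addl.
  have h3 : rnorm (Y n v - L v) < d by apply: n3P; rewrite /n leq_addl.
  rewrite rnormZ in h; lra.
have [Z ZE] := operator_of_fun Llin L1.
have Zapp x e : 0 < e -> exists n0, forall n, (n0 <= n)%N -> rnorm (Y n x - Z x) < e.
  by rewrite ZE; exact: Lapp.
have Ysym n : adjoint_pair (Y n) (Y n).
  elim: n => [u v|n IH u v].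
    by rewrite !Y0 /ip linear0l linear0r.
  by rewrite !YS ipZl ipZr ipDl ipDr Tsym !IH.
have Zsym : adjoint_pair Z Z.
  move=> u v; apply: (@eq_vanishing _ _ _ (rnorm u + rnorm v)) => d d0.
  have [n1 n1P] := Zapp u _ d0; have [n2 n2P] := Zapp v _ d0.
  pose n := (n1 + n2)%N.
  have -> : ip (Z u) v - ip u (Z v) = ip u (Y n v - Z v) - ip (Y n u - Z u) v.
    by rewrite ipBl ipBr Ysym; ring.
  apply: le_trans (ler_normB _ _) _.
  have h1 := ip_abs_le (Y n u - Z u) v; have h2 := ip_abs_le u (Y n v - Z v).
  have h3 : rnorm (Y n u - Z u) * rnorm v <= d * rnorm v.
    by rewrite ler_wpM2r ?rnorm_ge0// ltW// n1P// leq_addr.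
  have h4 : rnorm u * rnorm (Y n v - Z v) <= rnorm u * d.
    by rewrite ler_wpM2l ?rnorm_ge0// ltW// n2P// leq_addl.
  lra.
have ZZ x : Z (Z x) = (2%:R)%:C%C *: Z x - T x.
  apply/eqP; rewrite -subr_eq0; apply/eqP/rnorm_eq0.
  apply/eqP; rewrite eq_le rnorm_ge0 andbT.
  apply: (@ler_vanishing _ _ _ 4) => d d0.
  have [n1 n1P] := Zapp x _ d0; have [n2 n2P] := Zapp (Z x) _ d0.
  pose n := (n1 + n2)%N.
  have -> : Z (Z x) - ((2%:R)%:C%C *: Z x - T x) =
     (2%:R)%:C%C *: (Y n.+1 x - Z x) - (Y n (Y n x - Z x) + (Y n (Z x) - Z (Z x))).
    rewrite operatorB YS scalerBr scalerA -rmorphM divff ?pnatr_eq0// scale1r.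
    rewrite [Y n (Y n x) - _ + _]addrA subrK !opprB addrC.
    rewrite [RHS]addrC [Z _ - _ + _]addrA.
    rewrite [LHS]addrAC; congr (_ - _).
    by rewrite [in RHS](addrC (T x)) [in RHS]addrA subrK addrC.
  apply: le_trans (ler_rnormD _ _) _; rewrite rnormN add0r.
  rewrite rnormZ rnorm_real ger0_norm//.
  have h := ler_rnormD (Y n (Y n x - Z x)) (Y n (Z x) - Z (Z x)).
  have h1 : rnorm (Y n.+1 x - Z x) < d by apply: n1P; rewrite /n -addnS leq_addr.
  have h2 : rnorm (Y n (Y n x - Z x)) < d.
    apply: le_lt_trans (Yy _ _) _; apply: (@le_lt_trans _ _ (1 * rnorm (Y n x - Z x))).
      by rewrite ler_wpM2r ?rnorm_ge0.
    by rewrite mul1r n1P// leq_addr.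
  have h3 : rnorm (Y n (Z x) - Z (Z x)) < d by apply: n2P; rewrite /n leq_addl.
  lra.
exists (1 - Z) => [u v|x].
  by rewrite (_ : (1 - Z) u = u - Z u)// (_ : (1 - Z) v = v - Z v)// ipBl ipBr Zsym.
rewrite (_ : (1 - Z) _ = (x - Z x) - Z (x - Z x))// operatorB ZZ.
rewrite rmorph_nat scaler_nat mulr2n.
by rewrite opprB [Z x + Z x - _ - _]addrAC addrK addrA subrK.
Qed.

(** Polar decomposition in disguise.  With S^2 = k z^* z one has |S x| proportional
    to |z x|, so [douglas] gives D with z^* D = S whose range is in the closure of
    the range of z.  Then D^* z = S, and D S = k z since both sides map into that
    closure and have the same inner products with range z; hence z^* = k^-1 (D S)^* = k^-1 S D^* =
    k^-1 D^* z D^*. *)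
Lemma adjoint_in_ideal (z zs : 'B(H)) : adjoint_pair z zs ->
  exists a b : 'B(H), zs = a * z * b.
Proof.
move=> zzs.
have [C C0 zC] := bounded_operator_bound z.
pose c := C + 1; have c0 : 0 < c by rewrite ltr_wpDl.
have zc x : rnorm (z x) <= c * rnorm x.
  by apply: le_trans (zC x) _; rewrite ler_wpM2r ?rnorm_ge0// lerDl.
have zsc := adjoint_bound zzs zc.
(* Scaling by k makes 1 - k z^* z a contraction. *)
pose k := (c ^+ 2)^-1.
have k0 : 0 < k by rewrite invr_gt0 exprn_gt0.
pose T : 'B(H) := 1 - k%:C%C *: (zs * z).
have TE x : T x = x - k%:C%C *: zs (z x) by [].
have Tsym : adjoint_pair T T.
  by move=> x y; rewrite !TE ipBl ipBr ipZl ipZr -zzs (adjoint_pair_sym zzs).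
have kc : k * c ^+ 2 = 1 by rewrite mulVf// gt_eqF// exprn_gt0.
have T1 x : rnorm (T x) <= rnorm x.
  rewrite -(@ler_pXn2r _ 2)// ?nnegrE ?rnorm_ge0// TE rnormB2 ipZr -zzs ip_norm.
  rewrite rnormZ rnorm_real ger0_norm ?(ltW k0)// exprMn.
  have : k ^+ 2 * rnorm (zs (z x)) ^+ 2 <= k ^+ 2 * (c ^+ 2 * rnorm (z x) ^+ 2).
    rewrite ler_wpM2l ?sqr_ge0// -exprMn.
    by rewrite ler_pXn2r// ?nnegrE ?rnorm_ge0// mulr_ge0 ?rnorm_ge0// ltW.
  have -> : k ^+ 2 * (c ^+ 2 * rnorm (z x) ^+ 2) =
      (k * c ^+ 2) * (k * rnorm (z x) ^+ 2) by ring.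
  rewrite kc mul1r.
  have : 0 <= k * rnorm (z x) ^+ 2 by rewrite mulr_ge0 ?sqr_ge0// ltW.
  lra.
have [S Ssym SS] := symmetric_sqrt Tsym T1.
have {}SS x : S (S x) = k%:C%C *: zs (z x) by rewrite SS TE opprB addrC subrK.
have SSip x y : ip (S x) (S y) = k * ip (z x) (z y).
  by rewrite Ssym SS ipZr zzs.
have ic0 : 0 < c^-1 by rewrite invr_gt0.
have [x|D DE Dorth] := @douglas _ _ S z c^-1 (ltW ic0).
  rewrite -(@ler_pXn2r _ 2)// ?nnegrE ?rnorm_ge0//; last first.
    by rewrite mulr_ge0 ?rnorm_ge0// invr_ge0 ltW.
  by rewrite -ip_norm SSip ip_norm exprMn exprVn.
have [Ds Dadj] := adjoint_exists D.
have DsE x : Ds (z x) = S x.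
  apply: ip_ext => v; rewrite -Dadj ipC DE ipC//.
have DSE x : D (S x) = k%:C%C *: z x.
  apply/eqP; rewrite -subr_eq0; apply/eqP/ip_eq0.
  set w := D _ - _.
  have zw y : ip (z y) w = 0 by rewrite /w ipBr DE SSip ipZr subrr.
  by rewrite {1}/w ipBl ipZl zw (Dorth _ _ zw) mulr0 subrr.
exists ((c ^+ 2)%:C%C *: Ds), Ds.
apply: operator_ext => y; apply: ip_ext => x.
change (ip x (zs y) = ip x ((c ^+ 2)%:C%C *: Ds (z (Ds y)))).
by rewrite DsE ipZr -zzs -Ssym -Dadj DSE ipZl mulrA (mulrC _ k) kc mul1r.
Qed.
End Polar.

(** * Ideals and symmetric norms *)

Section SnIdeal.
Variables (R : realType) (H : hilbertType R).

Lemma ideal_mulr (I : set 'B(H)) (a x : 'B(H)) : two_sided_ideal I -> I x -> I (a * x).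
Proof. by case=> _ _ h Ix; rewrite -[a * x]mulr1; exact: h. Qed.

Lemma ideal_mull (I : set 'B(H)) (a x : 'B(H)) : two_sided_ideal I -> I x -> I (x * a).
Proof. by case=> _ _ h Ix; rewrite -[x]mul1r; exact: h. Qed.

Lemma scale_operator (c : R[i]) (x : 'B(H)) : c *: x = (c *: (1 : 'B(H))) * x.
Proof. by apply: operator_ext. Qed.

Lemma ideal_scale (I : set 'B(H)) (c : R[i]) (x : 'B(H)) :
  two_sided_ideal I -> I x -> I (c *: x).
Proof. by rewrite scale_operator; exact: ideal_mulr. Qed.

Lemma ideal_opp (I : set 'B(H)) (x : 'B(H)) : two_sided_ideal I -> I x -> I (- x).
Proof. by rewrite -scaleN1r; exact: ideal_scale. Qed.

Lemma ideal_sub (I : set 'B(H)) (x y : 'B(H)) :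
  two_sided_ideal I -> I x -> I y -> I (x - y).
Proof. by move=> II Ix Iy; case: (II) => _ h _; apply: h => //; exact: ideal_opp. Qed.

Lemma ideal_sum (I : set 'B(H)) n (x : 'I_n -> 'B(H)) :
  two_sided_ideal I -> (forall i, I (x i)) -> I (\sum_i x i).
Proof. by case=> I0 ID _ Ix; elim/big_ind: _. Qed.

Lemma opnorm_mul (a b : 'B(H)) : opnorm (a * b) <= opnorm a * opnorm b.
Proof.
apply: opnorm_le => [|x]; first by rewrite mulr_ge0 ?opnorm_ge0.
apply: le_trans (le_opnorm a (b x)) _.
by rewrite -mulrA ler_wpM2l ?opnorm_ge0 ?le_opnorm.
Qed.

Section Norm.
Variable I : sn_ideal H.
Let II := sn_ideal_two_sided I.
Implicit Types x y : 'B(H).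

Lemma sn_ge0 x : sn_set I x -> 0 <= sn_norm I x.
Proof. by have [[h _ _ _] _ _] := sn_ideal_symmetric I; exact: h. Qed.

Lemma snZ c x : sn_set I x -> sn_norm I (c *: x) = rnorm c * sn_norm I x.
Proof. by have [[_ _ h _] _ _] := sn_ideal_symmetric I; exact: h. Qed.

Lemma ler_snD x y : sn_set I x -> sn_set I y -> sn_norm I (x + y) <= sn_norm I x + sn_norm I y.
Proof. by have [[_ _ _ h] _ _] := sn_ideal_symmetric I; exact: h. Qed.

Lemma sn0 : sn_norm I 0 = 0.
Proof. by rewrite -(scale0r 0) snZ ?rnorm0 ?mul0r//; case: II. Qed.

Lemma snN x : sn_set I x -> sn_norm I (- x) = sn_norm I x.
Proof.
move=> Ix; rewrite -scaleN1r snZ// rnormN -(rmorph1 (real_complex R)).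
by rewrite rnorm_real normr1 mul1r.
Qed.

Lemma ler_snB x y : sn_set I x -> sn_set I y -> sn_norm I (x - y) <= sn_norm I x + sn_norm I y.
Proof. by move=> Ix Iy; rewrite -(snN Iy) ler_snD//; exact: ideal_opp. Qed.

Lemma sn_distC x y : sn_set I x -> sn_set I y -> sn_norm I (x - y) = sn_norm I (y - x).
Proof. by move=> Ix Iy; rewrite -snN ?opprB//; exact: ideal_sub. Qed.

Lemma ler_sn_distD z x y : sn_set I x -> sn_set I y -> sn_set I z ->
  sn_norm I (x - y) <= sn_norm I (x - z) + sn_norm I (z - y).
Proof.
by move=> Ix Iy Iz; rewrite -(subrK z x) -addrA addrK ler_snD//; exact: ideal_sub.
Qed.

Lemma ler_sn_sum n (x : 'I_n -> 'B(H)) : (forall i, sn_set I (x i)) ->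
  sn_norm I (\sum_i x i) <= \sum_i sn_norm I (x i).
Proof.
move=> Ix; suff [] : sn_set I (\sum_i x i) /\
    sn_norm I (\sum_i x i) <= \sum_i sn_norm I (x i) by [].
elim/big_ind2: _ => [|a c b d [Ia ac] [Ib bd]|i _] //.
- by rewrite sn0; split=> //; case: II.
- split; first by case: II => _ + _; apply.
  by apply: le_trans (ler_snD Ia Ib) _; exact: lerD.
Qed.

(** Cauchy-Schwarz for the complex form, from the real one at [inner h u *: u]. *)
Lemma inner_le (h u : H) : rnorm (inner h u) <= rnorm h * rnorm u.
Proof.
set c := inner h u; have [->|c0] := eqVneq (rnorm c) 0.
  by rewrite mulr_ge0 ?rnorm_ge0.
have {}c0 : 0 < rnorm c by rewrite lt_neqAle eq_sym c0 rnorm_ge0.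
rewrite -(ler_pM2r c0) -expr2.
have -> : rnorm c ^+ 2 = ip h (c *: u).
  by rewrite -ipZJ /ip linearZl_LR -/c -normCKC rnormE -rmorphXn.
by apply: le_trans (ip_le _ _) _; rewrite rnormZ mulrA mulrAC.
Qed.

(** With [b] the rank-one operator h |-> <h, u> u, the operator x b is zero or of
    rank one, so its symmetric norm is its operator norm; and x b maps u to
    |u|^2 x u. *)
Lemma le_sn_norm x (u : H) : sn_set I x -> rnorm (x u) <= sn_norm I x * rnorm u.
Proof.
move=> Ix; have [xu0|xu0] := eqVneq (x u) 0.
  by rewrite xu0 rnorm0 mulr_ge0 ?rnorm_ge0 ?sn_ge0.
have u0 : u != 0 by apply: contra_neq xu0 => ->; rewrite linear0.
have nu0 : 0 < rnorm u.
  by rewrite lt_neqAle rnorm_ge0 andbT eq_sym; apply: contra_neq u0 => /rnorm_eq0.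
pose f h := inner h u *: u.
have fl : linear f by move=> c h k; rewrite /f linearPl scalerDl scalerA.
have fb h : rnorm (f h) <= rnorm u ^+ 2 * rnorm h.
  rewrite /f rnormZ expr2 mulrAC ler_wpM2r ?rnorm_ge0//.
  by rewrite mulrC inner_le.
have [b bE] := operator_of_fun fl fb.
have Ixb : sn_set I (x * b) by exact: ideal_mull.
have [_ Nmul Nrank1] := sn_ideal_symmetric I.
have uu : inner u u = (rnorm u ^+ 2)%:C%C by rewrite innerE rnormE rmorphXn.
have xbE h : (x * b) h = inner h u *: x u.
  by rewrite -[LHS]/(x (b h)) bE linearZ.
have xb1 : rank_one (x * b).
  exists (x u) => //; apply/seteqP; split=> _ [h _ <-].
    by exists (inner h u) => //; rewrite xbE.
  exists ((h / (rnorm u ^+ 2)%:C%C) *: u) => //.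
  rewrite xbE linearZl_LR/= uu divfK//.
  by rewrite -(rmorph0 (real_complex R)) (inj_eq (@complexI R)) gt_eqF// exprn_gt0.
have b_le : opnorm b <= rnorm u ^+ 2.
  by apply: opnorm_le => [|h]; rewrite ?exprn_ge0 ?rnorm_ge0// bE.
have one_le : opnorm (1 : 'B(H)) <= 1 by apply: opnorm_le => // h; rewrite mul1r.
have : rnorm u ^+ 2 * rnorm (x u) <= rnorm u ^+ 2 * (sn_norm I x * rnorm u).
  have -> : rnorm u ^+ 2 * rnorm (x u) = rnorm ((x * b) u).
    by rewrite xbE uu rnormZ rnorm_real ger0_norm// exprn_ge0// rnorm_ge0.
  apply: le_trans (le_opnorm _ _) _; rewrite mulrA ler_wpM2r ?rnorm_ge0//.
  rewrite [_ * sn_norm _ _]mulrC -Nrank1// -[x in X in X <= _]mul1r.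
  apply: le_trans (Nmul _ _ _ Ix) _.
  apply: ler_pM; rewrite ?opnorm_ge0 ?mulr_ge0 ?opnorm_ge0 ?sn_ge0//.
  by rewrite ler_piMl ?sn_ge0.
by rewrite ler_pM2l// exprn_gt0.
Qed.

Lemma sn_complete (u : nat -> 'B(H)) : (forall n, sn_set I (u n)) ->
  (forall e : R, 0 < e -> exists n0, forall m n, (n0 <= m)%N -> (n0 <= n)%N ->
     sn_norm I (u m - u n) < e) ->
  exists2 x, sn_set I x & forall e : R, 0 < e ->
    exists n0, forall n, (n0 <= n)%N -> sn_norm I (u n - x) < e.
Proof.
move=> Iu uC; have [x Ix /cvgrPdist_lt ux] := sn_ideal_complete Iu uC.
exists x => // e /ux[n0 _ h]; exists n0 => n /h.
by rewrite sub0r normrN ger0_norm// sn_ge0//; exact: ideal_sub.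
Qed.

End Norm.

(** * The closed graph theorem between ideals *)

Section Baire.
Variables (J : sn_ideal H) (p : 'B(H) -> R).
Let JJ := sn_ideal_two_sided J.

(** Baire category: J is complete and is the union of the sets p <= n, so one of
    these is dense in a ball.  The proof builds nested balls that avoid the closure
    of each set in turn. *)
Lemma baire_level : exists x0 r (n : nat), [/\ sn_set J x0, 0 < r & forall y e, sn_set J y ->
  sn_norm J (y - x0) < r -> 0 < e ->
  exists a, [/\ sn_set J a, p a <= n%:R & sn_norm J (y - a) < e]].
Proof.
apply: contrapT => nh.
have step (n : nat) x r : exists x' r', sn_set J x -> 0 < r ->
    [/\ sn_set J x', 0 < r', r' <= n.+1%:R^-1, sn_norm J (x' - x) + r' <= r &
      forall a, sn_set J a -> sn_norm J (a - x') <= r' -> n%:R < p a].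
  have [[Jx r0]|h] := pselect (sn_set J x /\ 0 < r); last first.
    by exists 0, 0 => Jx r0; exfalso; exact: h.
  apply: contrapT => nstep; apply: nh; exists x, r, n; split=> // y e Jy yx e0.
  apply: contrapT => na; apply: nstep.
  exists y, (Num.min (e / 2) (Num.min (r - sn_norm J (y - x)) n.+1%:R^-1)) => _ _.
  split=> //.
  - by rewrite !lt_min divr_gt0// subr_gt0 yx invr_gt0 ltr0n.
  - by rewrite !ge_min lexx !orbT.
  - by rewrite -lerBrDl !ge_min lexx !orbT.
  - move=> a Ja; rewrite le_min => /andP[ae _]; rewrite ltNge; apply/negP => pa.
    apply: na; exists a; split=> //; rewrite sn_distC//.
    by apply: le_lt_trans ae _; rewrite ltr_pdivrMr// ltr_pMr// ltr1n.
have {}step (q : nat * ('B(H) * R)) : exists q' : 'B(H) * R, sn_set J q.2.1 -> 0 < q.2.2 ->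
    [/\ sn_set J q'.1, 0 < q'.2, q'.2 <= q.1.+1%:R^-1,
        sn_norm J (q'.1 - q.2.1) + q'.2 <= q.2.2 &
      forall a, sn_set J a -> sn_norm J (a - q'.1) <= q'.2 -> q.1%:R < p a].
  by case: q => n [x r]; have [x' [r' h]] := step n x r; exists (x', r').
have [f fP] := choice step.
(* The n-th ball avoids the set p <= n - 1 and has radius at most 1 / n. *)
pose s := fix s n : 'B(H) * R := if n is n'.+1 then f (n', s n') else (0, 1).
have s0 n : sn_set J (s n).1 /\ 0 < (s n).2.
  by elim: n => [|n [h1 h2]]; [split=> //; case: JJ|have [] := fP (n, s n) h1 h2].
have sP n : [/\ sn_set J (s n.+1).1, 0 < (s n.+1).2, (s n.+1).2 <= n.+1%:R^-1,
    sn_norm J ((s n.+1).1 - (s n).1) + (s n.+1).2 <= (s n).2 &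
    forall a, sn_set J a -> sn_norm J (a - (s n.+1).1) <= (s n.+1).2 -> n%:R < p a].
  exact: fP (n, s n) (s0 n).1 (s0 n).2.
have ss m n : (n <= m)%N -> sn_norm J ((s m).1 - (s n).1) + (s m).2 <= (s n).2.
  move=> /subnK <-; elim: (m - n)%N => [|k IH].
    by rewrite add0n subrr sn0 add0r.
  apply: le_trans IH; have [_ _ _ + _] := sP (k + n)%N.
  have := ler_sn_distD (s0 (k + n).+1).1 (s0 n).1 (s0 (k + n)%N).1.
  rewrite addSn; lra.
have [||y Jy yP] := @sn_complete J (fun n => (s n).1).
- by move=> n; have [] := s0 n.
- move=> e e0; have [n0 n0P] := @natSinv_lt R (e / 2) (divr_gt0 e0 (ltr0Sn _ 1)).
  exists n0.+1 => m n nm nn; cbv beta.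
  have [_ _ h _ _] := sP n0; have := n0P _ (leqnn n0).
  have := ss _ _ nm; have := ss _ _ nn; have [_ ?] := s0 m; have [_ ?] := s0 n.
  have := ler_sn_distD (s0 m).1 (s0 n).1 (s0 n0.+1).1.
  rewrite (sn_distC (s0 n0.+1).1 (s0 n).1).
  move: h; move: (n0.+1%:R^-1) => q; lra.
have ylt (n : nat) : n%:R < p y.
  have [_ _ _ _] := sP n; apply=> //.
  apply: (@ler_vanishing _ _ _ 1) => d d0; have [n0 n0P] := yP _ d0.
  pose m := maxn n0 n.+1.
  have := n0P m (leq_maxl _ _); have := ss m n.+1 (leq_maxr _ _).
  have [Jm ?] := s0 m; have := ler_sn_distD Jy (s0 n.+1).1 Jm.
  rewrite (sn_distC Jy Jm); lra.
have := ylt (Num.bound (p y)); apply/negP; rewrite -leNgt ltW//.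
have := archi_boundP (normr_ge0 (p y)); rewrite /Num.bound normr_id.
by apply: le_lt_trans; exact: ler_norm.
Qed.
End Baire.

Section ClosedGraph.
Variables (I J : sn_ideal H) (T : 'B(H) -> 'B(H)) (K : R).
Hypothesis TB : forall x y, T (x - y) = T x - T y.
Hypothesis TZ : forall (c : R) x, T (c%:C%C *: x) = c%:C%C *: T x.
Hypothesis TK : forall x, opnorm (T x) <= K * opnorm x.
Hypothesis TJ : forall x, sn_set J x -> sn_set I (T x).
Let II := sn_ideal_two_sided I.
Let JJ := sn_ideal_two_sided J.

(** [TK] makes the graph of [T] closed: the norms of I and J dominate the operator
    norm, so a limit in I of images under [T] is the image of the limit. *)
Lemma closed_graph : exists2 C : R, 0 <= C &
  forall y, sn_set J y -> sn_norm I (T y) <= C * sn_norm J y.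
Proof.
pose p x := sn_norm I (T x).
have [x0 [r [n [Jx0 r0 hn]]]] := @baire_level J p.
(* Differences move the dense ball to the origin, at the cost of doubling the level. *)
have ball0 y e : sn_set J y -> sn_norm J y < r -> 0 < e ->
    exists a, [/\ sn_set J a, p a <= 2 * n%:R & sn_norm J (y - a) < e].
  move=> Jy yr e0.
  have e20 : 0 < e / 2 by rewrite divr_gt0.
  have [||a [Ja pa ae]] := hn (x0 + y) (e / 2) _ _ e20.
  - by case: JJ => _ + _; apply.
  - by rewrite addrAC subrr add0r.
  have [|b [Jb pb be]] := hn x0 (e / 2) Jx0 _ e20; first by rewrite subrr sn0.
  exists (a - b); split; first exact: ideal_sub.
    rewrite /p TB; have := ler_snB (TJ Ja) (TJ Jb); move: pa pb; rewrite /p; lra.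
  have -> : y - (a - b) = ((x0 + y) - a) - (x0 - b).
    by rewrite !opprB (addrC x0) [RHS]addrAC (addrC b (- x0)) [y + x0 + _]addrA addrK addrA.
  have Jxy : sn_set J (x0 + y) by case: JJ => _ + _; apply.
  have := ler_snB (ideal_sub JJ Jxy Ja) (ideal_sub JJ Jx0 Jb); lra.
pose M := 2 * n%:R / r.
have M0 : 0 <= M by rewrite !mulr_ge0// invr_ge0 ltW.
(* By homogeneity every y of norm below t is within t / 2 of an a with p a <= M t. *)
have [f fP] : exists f : 'B(H) * R -> 'B(H), forall q, sn_set J q.1 -> 0 < q.2 ->
    sn_norm J q.1 < q.2 ->
    [/\ sn_set J (f q), p (f q) <= M * q.2 & sn_norm J (q.1 - f q) < q.2 / 2].
  suff /choice[f fP] (q : 'B(H) * R) : exists a, sn_set J q.1 -> 0 < q.2 ->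
    sn_norm J q.1 < q.2 ->
    [/\ sn_set J a, p a <= M * q.2 & sn_norm J (q.1 - a) < q.2 / 2] by exists f.
  case: q => y t /=.
  have [[Jy t0 yt]|h] := pselect [/\ sn_set J y, 0 < t & sn_norm J y < t]; last first.
    by exists 0 => *; exfalso; exact: h.
  pose c := r / t; have c0 : 0 < c by rewrite divr_gt0.
  have [|||a [Ja pa ae]] := ball0 (c%:C%C *: y) (r / 2).
  - exact: ideal_scale.
  - by rewrite snZ// rnorm_real gtr0_norm// /c mulrAC -mulrA gtr_pMr// ltr_pdivrMr// mul1r.
  - by rewrite divr_gt0.
  have ic0 : 0 < c^-1 by rewrite invr_gt0.
  exists (c^-1%:C%C *: a) => _ _ _; split; first exact: ideal_scale.
    rewrite /p TZ snZ ?rnorm_real ?gtr0_norm//; last exact: TJ.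
    rewrite -(ler_pM2l c0) mulrA divff ?gt_eqF// mul1r /M.
    have -> : c * (2 * n%:R / r * t) = 2 * n%:R by rewrite /c; field; rewrite !gt_eqF.
    exact: pa.
  have -> : y - c^-1%:C%C *: a = c^-1%:C%C *: (c%:C%C *: y - a).
    by rewrite scalerBr scalerA -rmorphM mulVf ?gt_eqF// scale1r.
  rewrite snZ ?rnorm_real ?gtr0_norm//; last by apply: ideal_sub => //; exact: ideal_scale.
  rewrite -(ltr_pM2l c0) mulrA divff ?gt_eqF// mul1r.
  have -> : c * (t / 2) = r / 2 by rewrite /c; field; rewrite !gt_eqF.
  exact: ae.
have main y t : sn_set J y -> 0 < t -> sn_norm J y < t -> p y <= 2 * M * t.
  move=> Jy t0 yt.
  pose ts k : R := t / 2 ^+ k.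
  have ts0 k : 0 < ts k by rewrite divr_gt0// exprn_gt0.
  have tsS k : ts k.+1 = ts k / 2.
    by rewrite /ts exprS; field; rewrite expf_neq0.
  have ts_small e : 0 < e -> exists k0, forall k, (k0 <= k)%N -> ts k < e.
    move=> e0; have [k0 k0P] := natSinv_lt (divr_gt0 e0 t0).
    exists k0 => k /k0P h; rewrite /ts -ltr_pdivlMl//.
    rewrite (le_lt_trans _ (_ : k.+1%:R^-1 < _))//; last by rewrite mulrC.
    by rewrite lef_pV2 ?posrE ?exprn_gt0// -natrX ler_nat ltn_expl.
  (* Remainders of the successive approximation; v is the image of the partial sums. *)
  pose s := fix s k := if k is k'.+1 then s k' - f (s k', ts k') else y.
  have sP k : sn_set J (s k) /\ sn_norm J (s k) < ts k.
    elim: k => [|k [h1 h2]]; first by rewrite /ts expr0 divr1.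
    have [/= h3 _] := fP (s k, ts k) h1 (ts0 k) h2.
    by rewrite -tsS; split=> //; exact: ideal_sub.
  have fsP k : p (f (s k, ts k)) <= M * ts k.
    by have [] := fP (s k, ts k) (sP k).1 (ts0 k) (sP k).2.
  pose v k := T (y - s k).
  have Iv k : sn_set I (v k) by apply: TJ; apply: ideal_sub => //; exact: (sP k).1.
  have vE k m : v m - v k = T (s k - s m).
    by rewrite -TB opprB (addrC (s k)) addrA [y - s m - y]addrAC subrr add0r addrC.
  have vdist k m : (k <= m)%N -> sn_norm I (v m - v k) <= 2 * M * (ts k - ts m).
    move=> /subnK <-; elim: (m - k)%N => [|j IH].
      by rewrite add0n !subrr sn0 mulr0.
    rewrite addSn; have := ler_sn_distD (Iv (j + k).+1) (Iv k) (Iv (j + k)%N).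
    have -> : v (j + k).+1 - v (j + k)%N = T (f (s (j + k)%N, ts (j + k)%N)).
      by rewrite vE /= subKr.
    by have := fsP (j + k)%N; move: IH; rewrite /p tsS; lra.
  have [|w Iw wP] := sn_complete Iv.
    move=> e e0.
    have d0 : 0 < e / (4 * M + 1) by rewrite divr_gt0// ltr_wpDl// mulr_ge0.
    have [k0 k0P] := ts_small _ d0; exists k0 => i j ki kj.
    have := ler_sn_distD (Iv i) (Iv j) (Iv k0).
    rewrite (sn_distC (Iv k0) (Iv j)).
    have := vdist _ _ ki; have := vdist _ _ kj.
    have : e / (4 * M + 1) * (4 * M + 1) = e.
      by rewrite divfK// gt_eqF// ltr_wpDl// mulr_ge0.
    have := k0P _ (leqnn k0); have := ts0 i; have := ts0 j; have := ts0 k0.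
    move: d0; move: (e / _) => d; nra.
  (* The closed graph: v k tends to both w and T y in the operator norm. *)
  have wE : w = T y.
    apply: operator_ext => u; apply/eqP; rewrite -subr_eq0; apply/eqP/rnorm_eq0.
    apply/eqP; rewrite eq_le rnorm_ge0 andbT.
    apply: (@ler_vanishing _ _ _ (`|K| * rnorm u + rnorm u)) => d d0.
    have [k1 k1P] := ts_small _ d0; have [k2 k2P] := wP _ d0.
    pose k := maxn k1 k2.
    have -> : w u - T y u = - T (s k) u - (v k - w) u.
      rewrite /v TB -[X in _ - X]/(T y u - T (s k) u - w u).
      by rewrite !opprB [RHS]addrCA addKr.
    apply: le_trans (ler_rnormD _ _) _; rewrite !rnormN add0r mulrDr.
    apply: lerD.
      apply: le_trans (le_opnorm _ _) _; rewrite mulrA ler_wpM2r ?rnorm_ge0//.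
      apply: le_trans (TK _) _; apply: (@le_trans _ _ (`|K| * opnorm (s k))).
        by rewrite ler_wpM2r ?opnorm_ge0 ?ler_norm.
      rewrite mulrC ler_wpM2r//; apply: (@le_trans _ _ (sn_norm J (s k))).
        apply: opnorm_le; first exact: sn_ge0 (sP k).1.
        by move=> x; apply: le_sn_norm; exact: (sP k).1.
      by apply/ltW/(lt_trans (sP k).2)/k1P; rewrite leq_maxl.
    apply: le_trans (le_sn_norm u (ideal_sub II (Iv k) Iw)) _.
    by rewrite ler_wpM2r ?rnorm_ge0// ltW// k2P// leq_maxr.
  rewrite /p -wE; apply: (@ler_vanishing _ _ _ 1) => d d0.
  have [k kP] := wP _ d0; have := kP _ (leqnn k).
  have v0 : v 0%N = 0 by have := TB 0 0; rewrite /v /= !subrr.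
  have := vdist 0%N k (leq0n k); rewrite v0 subr0.
  have := ler_snB (Iv k) (ideal_sub II (Iv k) Iw); rewrite subKr.
  have : ts 0%N = t by rewrite /ts expr0 divr1.
  have := ts0 k => tk ->.
  have : 0 <= M * ts k by rewrite mulr_ge0// ltW.
  lra.
exists (2 * M) => [|y Jy]; first by rewrite mulr_ge0.
apply: (@ler_vanishing _ _ _ (2 * M)) => d d0.
rewrite mulrC -mulrDl mulrC; apply: main => //.
  by rewrite ltr_wpDl// sn_ge0.
by rewrite ltrDl.
Qed.
End ClosedGraph.

End SnIdeal.

(** * Comparing topologies given by seminorms *)

Section Domination.
Variables (R : realType) (V : zmodType).
Implicit Types (p : V -> R) (P Q : set (V -> R)).

(** Coefficients are kept inside the sum so that each term can carry the constant
    of its own bounded map. *)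
Definition dominated p Q := exists (n : nat) (q : 'I_n -> V -> R) (C : 'I_n -> R),
  [/\ forall i, Q (q i), forall i, 0 <= C i & forall x, p x <= \sum_i C i * q i x].

Lemma dominatedS p P Q : P `<=` Q -> dominated p P -> dominated p Q.
Proof. by move=> PQ [n [q [C [h ? ?]]]]; exists n, q, C; split=> // i; exact/PQ/h. Qed.

Lemma open_seminorm_ball Q q x e : Q q -> 0 < e ->
  @open (seminorm_space Q) [set y : V | q (y - x) < e].
Proof.
move=> Qq e0; exists [set [set y | q (y - x) < e]]; last by rewrite bigcup_set1.
by move=> _ ->; apply: (@finI_from1 _ _ _ id); exists q, x, e.
Qed.

(** If y lies in the p-ball of radius e about x, then p(z - x) < e as soon as
    p(z - y) < e - p(y - x), which domination turns into finitely many conditions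
    on the seminorms of Q. *)
Lemma coarser_seminorm_topology P Q :
  (forall p, P p -> forall x y, p (x + y) <= p x + p y) ->
  (forall q, Q q -> q 0 = 0) ->
  (forall p, P p -> dominated p Q) ->
  coarser (seminorm_topology P) (seminorm_topology Q).
Proof.
move=> PD Q0 PQ _ [B sB <-].
change (@open (seminorm_space Q) (\bigcup_(A in B) id A)).
rewrite openE => y [C BC Cy].
apply: (@filterS _ _ _ C); first by move=> z Cz; exists C.
have [D sD DC] := sB _ BC; rewrite -DC; apply: filter_bigI => E DE.
have Ey : E y by move: Cy; rewrite -DC; apply.
have := sD _ DE; rewrite inE => -[p [x [e [Pp e0 EE]]]].
rewrite {}EE /= in Ey *.
have [n [q [c [Qq c0 pq]]]] := PQ _ Pp.
pose d := (e - p (y - x)) / (\sum_i c i + 1).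
have s0 : 0 <= \sum_i c i by exact: sumr_ge0.
have d0 : 0 < d by rewrite divr_gt0 ?subr_gt0// ltr_wpDl.
have qy i : @nbhs _ (seminorm_space Q) y [set z : V | q i (z - y) < d].
  apply: open_nbhs_nbhs; split; first exact: open_seminorm_ball.
  by rewrite /= subrr (Q0 _ (Qq i)).
have := @filter_forall _ _ _ _ (nbhs_filter (y : seminorm_space Q)) qy.
apply: filterS => z zd; rewrite /=.
have -> : z - x = (z - y) + (y - x) by rewrite addrA subrK.
apply: le_lt_trans (PD _ Pp _ _) _; rewrite -ltrBrDr.
apply: le_lt_trans (pq _) _.
apply: (@le_lt_trans _ _ (\sum_i c i * d)).
  by apply: ler_sum => i _; rewrite ler_wpM2l//; exact/ltW/zd.
rewrite -mulr_suml.
have : (\sum_i c i + 1) * d = e - p (y - x).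
  by rewrite mulrC divfK// gt_eqF// ltr_wpDl.
by move=> <-; rewrite mulrDl mul1r ltrDl.
Qed.

End Domination.

(** * Adjoints in ideals and the residual *)

Section Adjoint.
Variables (R : realType) (H : hilbertType R).
Implicit Types (x y z : 'B(H)) (I J : set 'B(H)).

Definition adjoint x : 'B(H) := projT1 (cid (adjoint_exists x)).

Lemma adjointP x : adjoint_pair x (adjoint x).
Proof. exact: projT2 (cid (adjoint_exists x)). Qed.

Lemma adjoint_uniq x y z : adjoint_pair x y -> adjoint_pair x z -> y = z.
Proof. by move=> xy xz; apply: operator_ext => u; apply: ip_ext => v; rewrite -xy xz. Qed.

Lemma adjointK : involutive adjoint.
Proof.
move=> x; apply: (@adjoint_uniq (adjoint x)); first exact: adjointP.
exact/adjoint_pair_sym/adjointP.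
Qed.

Lemma adjointM x y : adjoint (x * y) = adjoint y * adjoint x.
Proof.
apply: (@adjoint_uniq (x * y)); first exact: adjointP.
by move=> u v; rewrite [LHS](adjointP x (y u)) adjointP.
Qed.

Lemma adjointD x y : adjoint (x + y) = adjoint x + adjoint y.
Proof.
apply: (@adjoint_uniq (x + y)); first exact: adjointP.
by move=> u v; rewrite [LHS]ipDl !adjointP -ipDr.
Qed.

Lemma adjoint_sum n (x : 'I_n -> 'B(H)) : adjoint (\sum_i x i) = \sum_i adjoint (x i).
Proof.
apply: (big_morph adjoint adjointD).
by apply/(addIr (adjoint 0)); rewrite -adjointD !add0r.
Qed.

Lemma ideal_adjoint I x : two_sided_ideal I -> I x -> I (adjoint x).
Proof.
by move=> [_ _ h] Ix; have [a [b ->]] := adjoint_in_ideal (adjointP x); exact: h.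
Qed.

Lemma residual_ideal I J : two_sided_ideal I -> two_sided_ideal J ->
  two_sided_ideal (residual I J).
Proof.
move=> II JJ; split=> [y Jy|x y Ix Iy w Jw|a x b Ix w Jw].
- by rewrite mul0r; case: II.
- by rewrite mulrDl; case: II => _ + _; apply; [exact: Ix|exact: Iy].
- by rewrite -mulrA -mulrA; apply: ideal_mulr => //; apply: Ix; exact: ideal_mulr.
Qed.

(** The left and right descriptions of (I : J) agree: (y z)^* = z^* y^*, and all the
    ideals concerned, (I : J) included, are self-adjoint. *)
Lemma residual_right I J y z : two_sided_ideal I -> two_sided_ideal J ->
  residual I J z -> J y -> I (y * z).
Proof.
move=> II JJ Iz Jy; rewrite -[y * z]adjointK; apply: ideal_adjoint => //.
rewrite adjointM; apply: (ideal_adjoint (residual_ideal II JJ) Iz).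
exact: ideal_adjoint.
Qed.

Lemma ideal_mul_residual I J : two_sided_ideal I -> two_sided_ideal J ->
  ideal_mul J (residual I J) `<=` I.
Proof.
move=> II JJ _ [n [y [z [Jy Iz ->]]]]; apply: ideal_sum => // i.
exact: residual_right (Iz i) (Jy i).
Qed.

End Adjoint.

(** * Domination of the seminorms *)

Section Main.
Variables (R : realType) (H : hilbertType R) (I J : sn_ideal H).
Let II := sn_ideal_two_sided I.
Let JJ := sn_ideal_two_sided J.

Lemma residual_bounded_left (z : 'B(H)) : residual I J z -> exists2 C : R, 0 <= C &
  forall y, sn_set J y -> sn_norm I (z * y) <= C * sn_norm J y.
Proof.
move=> Iz; apply: (@closed_graph _ _ _ _ _ (opnorm z)) => [x y|c x|x|x Jx].
- exact: mulrBr.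
- by apply: operator_ext => u; exact: linearZ.
- exact: opnorm_mul.
- exact: Iz.
Qed.

Lemma residual_bounded_right (z : 'B(H)) : residual I J z -> exists2 C : R, 0 <= C &
  forall y, sn_set J y -> sn_norm I (y * z) <= C * sn_norm J y.
Proof.
move=> Iz; apply: (@closed_graph _ _ _ _ _ (opnorm z)) => [x y|c x|x|x Jx].
- exact: mulrBl.
- exact: operator_ext.
- by rewrite mulrC; exact: opnorm_mul.
- exact: residual_right Iz Jx.
Qed.

Lemma mu_seminorm_dominated y : ideal_mul J (residual I J) y ->
  dominated (fun x => sn_norm I (x * y)) (mu_seminorms J).
Proof.
move=> [n [a [z [Ja Iz ->]]]].
have /choice[C CP] i : exists C : R, 0 <= C /\
    forall w, sn_set J w -> sn_norm I (w * z i) <= C * sn_norm J w.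
  by have [C ? ?] := residual_bounded_right (Iz i); exists C.
exists n, (fun i x => sn_norm J (x * a i)), C; split=> [i|i|x].
- by exists (a i).
- by have [] := CP i.
have Jxa i : sn_set J (x * a i) by exact: ideal_mulr.
rewrite mulr_sumr; apply: le_trans (ler_sn_sum _) _ => [i|].
  by rewrite mulrA; exact: residual_right (Iz i) _.
by apply: ler_sum => i _; rewrite mulrA; have [_] := CP i; exact.
Qed.

(** Taking adjoints in y^* = sum_i a_i z_i puts the factors in the order needed
    here: y = sum_i z_i^* a_i^*. *)
Lemma rmu_seminorm_dominated y : ideal_mul J (residual I J) (adjoint y) ->
  dominated (fun x => sn_norm I (y * x)) (rmu_seminorms J).
Proof.
move=> [n [a [z [Ja Iz yE]]]].
have {yE} -> : y = \sum_i adjoint (z i) * adjoint (a i).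
  rewrite -[LHS]adjointK yE adjoint_sum.
  by apply: eq_bigr => i _; exact: adjointM.
have Iz' i := ideal_adjoint (residual_ideal II JJ) (Iz i).
have /choice[C CP] i : exists C : R, 0 <= C /\
    forall w, sn_set J w -> sn_norm I (adjoint (z i) * w) <= C * sn_norm J w.
  by have [C ? ?] := residual_bounded_left (Iz' i); exists C.
exists n, (fun i x => sn_norm J (adjoint (a i) * x)), C; split=> [i|i|x].
- by exists (adjoint (a i)) => //; exact: ideal_adjoint.
- by have [] := CP i.
have Jxa i : sn_set J (adjoint (a i) * x) by apply: ideal_mull => //; exact: ideal_adjoint.
rewrite mulr_suml; apply: le_trans (ler_sn_sum _) _ => [i|].
  by rewrite -mulrA; exact: Iz'.
by apply: ler_sum => i _; rewrite -mulrA; have [_] := CP i; exact.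
Qed.

Lemma mu_seminormD p : mu_seminorms I p -> forall x y, p (x + y) <= p x + p y.
Proof. by move=> [a Ia <-] x y; rewrite mulrDl ler_snD//; exact: ideal_mulr. Qed.

Lemma rmu_seminormD p : rmu_seminorms I p -> forall x y, p (x + y) <= p x + p y.
Proof. by move=> [a Ia <-] x y; rewrite mulrDr ler_snD//; exact: ideal_mull. Qed.

Lemma mu_seminorm0 p : mu_seminorms I p -> p 0 = 0.
Proof. by move=> [a Ia <-]; rewrite mul0r sn0. Qed.

Lemma rmu_seminorm0 p : rmu_seminorms I p -> p 0 = 0.
Proof. by move=> [a Ia <-]; rewrite mulr0 sn0. Qed.

End Main.

Theorem proposition1p16 (R : realType) (H : hilbertType R) (I J : sn_ideal H) :
  ((I : set 'B(H)) = ideal_mul J (residual I J) <->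
   I `<=` ideal_mul J (residual I J)) /\
  ((I : set 'B(H)) = ideal_mul J (residual I J) ->
   [/\ coarser (mu I) (mu J),
       coarser (rmu I) (rmu J) &
       coarser (mu_star I) (mu_star J)]).
Proof.
have II := sn_ideal_two_sided I; have JJ := sn_ideal_two_sided J.
split; first split=> [{1}->//|IJ].
  by apply/seteqP; split=> //; exact: ideal_mul_residual.
move=> IJ.
have muD p : mu_seminorms I p -> dominated p (mu_seminorms J).
  by move=> [y Iy <-]; apply: mu_seminorm_dominated; rewrite -IJ.
have rmuD p : rmu_seminorms I p -> dominated p (rmu_seminorms J).
  by move=> [y Iy <-]; apply: rmu_seminorm_dominated; rewrite -IJ; exact: ideal_adjoint.
split; apply: coarser_seminorm_topology => //.
- exact: mu_seminormD.
- exact: mu_seminorm0.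
- exact: rmu_seminormD.
- exact: rmu_seminorm0.
- by move=> p []; [exact: mu_seminormD|exact: rmu_seminormD].
- by move=> p []; [exact: mu_seminorm0|exact: rmu_seminorm0].
- move=> p [/muD|/rmuD]; apply: dominatedS => q qJ; [by left|by right].
Qed.
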